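(* Let $g_a,g_b:\mathbb{R}\to[0,\infty)$ be Borel probability density functions, and let $a,b$ be independent real random variables with densities $g_a,g_b$ respectively. Let $S=2\sqrt{a^2+b^2}$ be the level spacing of the real symmetric random matrix $\begin{pmatrix} a & b\\ b & -a\end{pmatrix}$. Then $S$ has the probability density $$P(S)=\frac{S}{4}\int_0^{2\pi}g_a\!\left(\tfrac{S}{2}\cos\varphi\right)g_b\!\left(\tfrac{S}{2}\sin\varphi\right)d\varphi,\qquad S>0.$$ If moreover $g_a$ and $g_b$ are regular at $0$, then $$\lim_{S\to0^+}\frac{P(S)}{S}=\frac{\pi}{2}\,g_a(0)\,g_b(0),$$ where $P$ is given by the displayed formula; in particular, if $g_a(0)>0$ and $g_b(0)>0$, the level repulsion is linear (repulsion exponent $\rho=1$).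
   Context: The matrix $\begin{pmatrix} a & b\\ b & -a\end{pmatrix}$ has real eigenvalues $\pm\sqrt{a^2+b^2}$; the level spacing is the difference of the two eigenvalues. A density $g$ is called regular at $0$ if it is finite-valued and continuous at $0$. The repulsion exponent is $\rho$ if $P(S)$ is asymptotically a positive constant times $S^{\rho}$ as $S\to0^+$. *)

(* Defs.v *)
From HB Require Import structures.
From mathcomp Require Import all_boot all_order all_algebra.
From mathcomp Require Import all_classical all_reals all_analysis.
From mathcomp Require Import measurable_realfun.
Import Order.TTheory GRing.Theory Num.Theory.
Import numFieldNormedType.Exports.

Set Implicit Arguments.
Unset Strict Implicit.
Unset Printing Implicit Defensive.

Local Open Scope classical_set_scope.
Local Open Scope ring_scope.

Definition real_sym_mx (R : realType) (a b : R) : 'M[R]_2 :=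
  @block_mx R 1 1 1 1 a%:M b%:M b%:M (- a)%:M.

(* Eigenvalues are counted with multiplicity, so a double eigenvalue gives
   spacing 0. *)
Definition is_level_spacing (R : realType) (M : 'M[R]_2) (s : R) : Prop :=
  exists l1 l2 : R,
    [/\ l1 <= l2, char_poly M = ('X - l1%:P) * ('X - l2%:P) & s = l2 - l1].

Definition level_spacing d (T : measurableType d) (R : realType)
    (P : probability T R) (a b : {RV P >-> R}) : T -> R :=
  fun t => 2 * Num.sqrt (a t ^+ 2 + b t ^+ 2).

Lemma measurable_level_spacing d (T : measurableType d) (R : realType)
    (P : probability T R) (a b : {RV P >-> R}) :
  measurable_fun [set: T] (level_spacing a b).
Proof.
have msqrt : measurable_fun [set: R] (@Num.sqrt R).
  by apply: continuous_measurable_fun; exact: sqrt_continuous.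
apply: measurable_funM => //; apply: (measurableT_comp msqrt).
by apply: measurable_funD; apply: measurable_funX; exact: measurable_funPT.
Qed.

HB.instance Definition _ d (T : measurableType d) (R : realType)
    (P : probability T R) (a b : {RV P >-> R}) :=
  isMeasurableFun.Build d _ T R (level_spacing a b)
    (measurable_level_spacing a b).

Definition independent_RVs d (T : measurableType d) (R : realType)
    (P : probability T R) (X Y : {RV P >-> R}) : Prop :=
  forall A B : set R, measurable A -> measurable B ->
    (P (X @^-1` A `&` Y @^-1` B) = P (X @^-1` A) * P (Y @^-1` B))%E.
Arguments independent_RVs {d T R} P X Y.

(* Densities are extended-real valued because the angular integral below can
   be +oo for some s, even when the densities of the entries are finite. *)
Definition is_pdf (R : realType) (f : R -> \bar R) : Prop :=
  [/\ measurable_fun [set: R] f,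
      forall x, (0 <= f x)%E &
      (\int[lebesgue_measure]_x f x = 1)%E].

Definition has_density d (T : measurableType d) (R : realType)
    (P : probability T R) (X : {RV P >-> R}) (f : R -> \bar R) : Prop :=
  is_pdf f /\
  forall A : set R, measurable A ->
    (distribution P X A = \int[lebesgue_measure]_(x in A) f x)%E.
Arguments has_density {d T R} P X f.

(* Only the values at s > 0 are meaningful. *)
Definition spacing_pdf (R : realType) (ga gb : R -> R) (s : R) : \bar R :=
  ((s / 4)%:E *
   \int[lebesgue_measure]_(phi in `[0%R, (2 * pi)%R])
     (ga (s / 2 * cos phi) * gb (s / 2 * sin phi))%:E)%E.

(* p(s) ~ c * s^rho as s -> 0+, for some c > 0. *)
Definition repulsion_exponent (R : realType) (p : R -> \bar R) (rho : R) :
    Prop :=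
  exists2 c : R, 0 < c &
    (p s * ((s `^ rho)^-1)%:E)%E @[s --> 0^'+] --> c%:E.

(* Main.v *)
Require Import Defs.
From HB Require Import structures.
From mathcomp Require Import all_boot all_order all_algebra.
From mathcomp Require Import all_classical all_reals all_analysis.
From mathcomp Require Import measurable_realfun.
From mathcomp Require Import ring lra.
Import Order.TTheory GRing.Theory Num.Theory.
Import numFieldNormedType.Exports.

Set Implicit Arguments.
Unset Strict Implicit.
Unset Printing Implicit Defensive.

Local Open Scope classical_set_scope.
Local Open Scope ring_scope.

(** For x <> 0 substitute y = x * tan t, exchange the two integrals, and then
    substitute x = r * cos t: the weights |x|, |cos t| and 1 + tan^2 t multiply
    to |r|.  This gives polar coordinates with signed radius r and angle t in
    ]-pi/2, pi/2[; moving the part r < 0 to the angle t + pi gives the usual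
    ones.  Each one-variable substitution holds for all nonnegative measurable
    functions as soon as the image of the weighted measure has the right value
    on the intervals ]a, b].  The density of the spacing is obtained by applying
    polar coordinates to the joint density of the two entries on the event
    2 * r in A, and the limit at 0 by bounding the integrand uniformly in the
    angle. *)

(** * Measures given by a density *)

Section density.
Local Open Scope ereal_scope.
Context d (T : measurableType d) (R : realType).
Variable mu : {measure set T -> \bar R}.

Import HBNNSimple.

(** Simple functions increasing to [f], with monotone convergence on both sides, reduce the claim to
    indicators, where it is the hypothesis on [nu]. *)
Lemma ge0_integral_density (nu : {measure set T -> \bar R}) (w : T -> R)
    (f : T -> \bar R) :
  measurable_fun setT w -> (forall x, (0 <= w x)%R) ->
  (forall A, measurable A -> nu A = \int[mu]_(x in A) (w x)%:E) ->
  measurable_fun setT f -> (forall x, 0 <= f x) ->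
  \int[nu]_x f x = \int[mu]_x (f x * (w x)%:E).
Proof.
move=> mw w0 nuE mf f0; pose h := nnsfun_approx measurableT mf.
have hf x : (h n x)%:E @[n --> \oo] --> f x by exact: cvg_nnsfun_approx.
have mwE : measurable_fun setT (fun x => (w x)%:E) by exact/measurable_EFinP.
transitivity (limn (fun n => \int[nu]_x (h n x)%:E)).
  rewrite -monotone_convergence//.
  - by apply: eq_integral => x _; apply/esym/cvg_lim => //; exact: hf.
  - by move=> n; exact/measurable_EFinP.
  - by move=> n x _; rewrite lee_fin.
  - by move=> x _ a b ab; rewrite lee_fin; exact/lefP/nd_nnsfun_approx.
transitivity (limn (fun n => \int[mu]_x ((h n x)%:E * (w x)%:E))); last first.
  rewrite -monotone_convergence//.
  - by apply: eq_integral => x _; apply/cvg_lim => //; exact: cvgeZr.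
  - by move=> n; apply: emeasurable_funM => //; exact/measurable_EFinP.
  - by move=> n x _; rewrite mule_ge0 ?lee_fin.
  - move=> x _ a b ab; rewrite lee_wpmul2r ?lee_fin//.
    exact/lefP/nd_nnsfun_approx.
congr (limn _); apply/funext => n.
under eq_integral do rewrite fimfunE -fsumEFin//.
rewrite ge0_integral_fsum//; last 2 first.
  - by move=> r; exact/measurable_EFinP/measurableT_comp.
  - by move=> r x _; rewrite EFinM nnfun_muleindic_ge0.
under [RHS]eq_integral.
  move=> x _; rewrite fimfunE -fsumEFin// ge0_mule_fsuml; last first.
    by move=> r; exact: nnfun_muleindic_ge0.
  over.
rewrite ge0_integral_fsum//; last 2 first.
  - move=> r; apply: emeasurable_funM => //.
    exact/measurable_EFinP/measurableT_comp.
  - by move=> r x _; rewrite mule_ge0 ?lee_fin//; exact: nnfun_muleindic_ge0.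
(* The terms are compared value by value. As [r] lies in the range of the nonnegative [h n], it is
   nonnegative and can be pulled out of the integral. *)
apply: eq_fsbigr => r rh.
rewrite integralZl_indic_nnsfun// integral_indic// setIT nuE//.
under [RHS]eq_integral do rewrite EFinM -muleA muleC (muleC (\1__ _)%:E).
rewrite ge0_integralZr//; last 3 first.
  - apply: emeasurable_funM => //; exact/measurable_EFinP.
  - by move=> t _; rewrite mule_ge0 ?lee_fin.
  - by move: rh; rewrite inE => -[t _ <-]; rewrite lee_fin.
rewrite muleC; congr (_ * _); rewrite integral_mkcond.
by apply: eq_integral => x _; rewrite epatch_indic.
Qed.

(** Packages a weight as a genuine measure, so that its image under a map can be compared with
    Lebesgue measure by a uniqueness theorem. *)
Lemma density_measure (w : T -> R) :
  measurable_fun setT w -> (forall x, (0 <= w x)%R) ->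
  exists nu : {measure set T -> \bar R},
    forall A, nu A = \int[mu]_(x in A) (w x)%:E.
Proof.
move=> mw w0; pose nu A := \int[mu]_(x in A) (w x)%:E.
have nu0 : nu set0 = 0 by rewrite /nu integral_set0.
have nu_ge0 A : 0 <= nu A by apply: integral_ge0 => x _; rewrite lee_fin.
have nu_sigma : semi_sigma_additive nu.
  move=> A mA tA mUA; rewrite /nu ge0_integral_bigcup//; last 2 first.
  - by apply: measurable_funTS; exact/measurable_EFinP.
  - by move=> x _; rewrite lee_fin.
  by apply: is_cvg_ereal_nneg_natsum_cond => n _ _; exact: nu_ge0.
pose nuM := isMeasure.Build _ _ _ nu nu0 nu_ge0 nu_sigma.
by exists (HB.pack nu nuM : {measure set T -> \bar R}).
Qed.

End density.

Lemma integral_indicE d (T : measurableType d) (R : realType)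
    (mu : {measure set T -> \bar R}) (D : set T) (f : T -> \bar R) :
  (\int[mu]_(x in D) f x = \int[mu]_x (f x * (\1_D x)%:E))%E.
Proof.
by rewrite integral_mkcond; apply: eq_integral => x _; rewrite epatch_indic.
Qed.

(** * Changes of variable on the real line *)

Section change_of_variables.
Local Open Scope ereal_scope.
Context {R : realType}.
Notation mu := (@lebesgue_measure R).

(** The interval hypothesis says that the image under [h] of the measure with density [w] gives each
    []a, b]] its length. By uniqueness this image is Lebesgue measure, and integrating [f] against
    an image measure amounts to integrating [f \o h]. *)
Lemma ge0_lebesgue_change_of_variables (h w : R -> R) (f : R -> \bar R) :
  measurable_fun setT h -> measurable_fun setT w ->
  (forall x, (0 <= w x)%R) ->
  (forall a b : R, (a < b)%R ->
    \int[mu]_(x in h @^-1` `]a, b]) (w x)%:E = (b - a)%:E) ->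
  measurable_fun setT f -> (forall x, 0 <= f x) ->
  \int[mu]_x f x = \int[mu]_x (f (h x) * (w x)%:E).
Proof.
move=> mh mw w0 hab mf f0; have [nu nuE] := density_measure mu mw w0.
pose h' : measurableTypeR R -> measurableTypeR R := h.
have mh' : measurable_fun setT h' by [].
transitivity (\int[pushforward nu h']_x f x).
  apply: eq_measure_integral => //= A mA _.
  apply: lebesgue_measure_unique => //= X [[a b]] _ <-.
  rewrite lebesgue_measure_itv/= lte_fin /pushforward/= nuE.
  have [ab|ba] := ltP a b; first by rewrite hab.
  by rewrite set_itv_ge ?bnd_simp -?leNgt// preimage_set0 integral_set0.
rewrite (ge0_integral_pushforward mh')//= preimage_setT.
have mfh : measurable_fun setT (f \o h) by exact: measurableT_comp.
exact: (@ge0_integral_density _ (measurableTypeR R) R mu nu w (f \o h) mw w0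
  (fun A _ => nuE A) mfh (fun x => f0 (h x))).
Qed.

(** The preimage of []a, b]] is an interval of length [(b - a) / |c|], closed on the left instead of
    the right when [c < 0]. *)
Lemma ge0_lebesgue_affine (c e : R) (f : R -> \bar R) :
  (c != 0)%R -> measurable_fun setT f -> (forall x, 0 <= f x) ->
  \int[mu]_x f x = \int[mu]_x (f (c * x + e)%R * `|c|%:E).
Proof.
move=> c0 mf f0; apply: ge0_lebesgue_change_of_variables => //.
  by apply: measurable_funD => //; exact: measurable_funM.
move=> a b ab; have /orP[cn|cp] : (c < 0)%R || (0 < c)%R by rewrite -neq_lt.
- have -> : (fun x => c * x + e)%R @^-1` `]a, b] =
      `[((b - e) / c)%R, ((a - e) / c)%R[%classic.
    apply/seteqP; split => x /=; rewrite !in_itv/= ltr_ndivlMr// ler_ndivrMr//;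
      by rewrite ltrBlDr lerBrDr mulrC => /andP[-> ->].
  rewrite integral_cst//= lebesgue_measure_itv/= lte_fin ltr_nM2r ?invr_lt0//.
  rewrite ltrD2r ab -EFinD -EFinM ltr0_norm//; congr EFin; field.
  by rewrite lt_eqF.
- have -> : (fun x => c * x + e)%R @^-1` `]a, b] =
      `]((a - e) / c)%R, ((b - e) / c)%R]%classic.
    apply/seteqP; split => x /=; rewrite !in_itv/= ltr_pdivrMr// ler_pdivlMr//;
      by rewrite ltrBlDr lerBrDr mulrC.
  rewrite integral_cst//= lebesgue_measure_itv/= lte_fin ltr_pM2r ?invr_gt0//.
  rewrite ltrD2r ab -EFinD -EFinM gtr0_norm//; congr EFin; field.
  by rewrite gt_eqF.
Qed.

End change_of_variables.

(** * Tonelli's theorem with one variable confined to a subset *)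

Section fubini_tonelli_in.
Local Open Scope ereal_scope.
Context d1 d2 (T1 : measurableType d1) (T2 : measurableType d2) (R : realType).
Variables (m1 : {sigma_finite_measure set T1 -> \bar R}).
Variables (m2 : {sigma_finite_measure set T2 -> \bar R}).

(** Absorbing the indicator of [D] into the integrand reduces this to the whole product space. *)
Lemma fubini_tonelli_in (D : set T2) (f : T1 * T2 -> \bar R) :
  measurable D -> measurable_fun setT f -> (forall z, 0 <= f z) ->
  \int[m1]_x \int[m2]_(y in D) f (x, y) =
  \int[m2]_(y in D) \int[m1]_x f (x, y).
Proof.
move=> mD mf f0; pose g (z : T1 * T2) := f z * (\1_D z.2)%:E.
have mg : measurable_fun setT g.
  apply: emeasurable_funM => //; apply/measurable_EFinP.
  by apply: (@measurableT_comp _ _ _ _ _ _ (\1_D : T2 -> R) _ snd).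
have g0 z : 0 <= g z by rewrite mule_ge0// lee_fin.
transitivity (\int[m1]_x \int[m2]_y g (x, y)).
  by apply: eq_integral => x _; rewrite integral_indicE.
rewrite (fubini_tonelli g)// [RHS]integral_indicE; apply: eq_integral => y _.
by rewrite /g/= ge0_integralZr ?lee_fin//; exact: measurableT_comp.
Qed.

Lemma measurable_integral_in (D : set T2) (f : T1 * T2 -> \bar R) :
  measurable D -> measurable_fun setT f -> (forall z, 0 <= f z) ->
  measurable_fun setT (fun x => \int[m2]_(y in D) f (x, y)).
Proof.
move=> mD mf f0; pose g (z : T1 * T2) := f z * (\1_D z.2)%:E.
have mg : measurable_fun setT g.
  apply: emeasurable_funM => //; apply/measurable_EFinP.
  by apply: (@measurableT_comp _ _ _ _ _ _ (\1_D : T2 -> R) _ snd).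
have g0 z : 0 <= g z by rewrite mule_ge0// lee_fin.
rewrite (_ : (fun x => _) = fubini_F m2 g).
  exact: measurable_fun_fubini_tonelli_F.
by apply/funext => x; rewrite integral_indicE.
Qed.

End fubini_tonelli_in.

(** * Polar coordinates in the plane *)

Section polar_coordinates.
Local Open Scope ereal_scope.
Context {R : realType}.
Notation mu := (@lebesgue_measure R).
Local Notation halfturn := (`](- (pi / 2))%R, (pi / 2)%R[%classic : set R).

Let cos_halfturn_neq0 (x : R) : halfturn x -> cos x != 0%R.
Proof. by rewrite /= in_itv/= => /cos_gt0_pihalf; rewrite lt0r => /andP[]. Qed.

(** The weight is the derivative of [tan], so by the fundamental theorem of calculus its integral
    from [atan a] to [atan b] is [b - a]. *)
Lemma ge0_lebesgue_tan (f : R -> \bar R) :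
  measurable_fun setT f -> (forall x, 0 <= f x) ->
  \int[mu]_x f x =
  \int[mu]_(x in halfturn) (f (tan x) * (1 + tan x ^+ 2)%:E).
Proof.
(* Outside the half-turn the weight [w] vanishes, so the default value 0 of [h] there does no harm,
   even when 0 lies in []a, b]]. *)
move=> mf f0; pose h : R -> R := tan \_ halfturn.
pose w : R -> R := (fun x => 1 + tan x ^+ 2)%R \_ halfturn.
have mtan : measurable_fun halfturn (@tan R).
  apply: open_continuous_measurable_fun; first exact: interval_open.
  by move=> x /set_mem/cos_halfturn_neq0; exact: continuous_tan.
have mh : measurable_fun setT h.
  by apply: (measurable_restrictT tan _).1.
have mw : measurable_fun setT w.
  apply: (measurable_restrictT _ _).1 => //; apply: measurable_funD => //.
  exact: measurable_funX.
have w0 x : (0 <= w x)%R.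
  by rewrite /w patchE; case: ifPn => // _; rewrite addr_ge0// sqr_ge0.
rewrite (@ge0_lebesgue_change_of_variables _ h w)//.
  rewrite [RHS]integral_mkcond; apply: eq_integral => x _.
  by rewrite /h /w !patchE; case: ifPn => //; rewrite mule0.
move=> a b ab.
have atan_halfturn (x : R) : halfturn (atan x).
  by rewrite /= in_itv/= atan_gtNpi2 atan_ltpi2.
have tan_itv (x : R) : halfturn x ->
    (a < tan x <= b)%R = (atan a < x <= atan b)%R.
  move=> xh; rewrite -[in LHS](atanK a) -[in LHS](atanK b).
  have ha := atan_halfturn a; have hb := atan_halfturn b.
  by rewrite ltr_tan// [(tan x <= _)%R]leNgt ltr_tan// -leNgt.
have cos_neq0 x : x \in `[atan a, atan b] -> cos x != 0%R.
  rewrite in_itv/= => /andP[ax xb]; apply: cos_halfturn_neq0.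
  rewrite /= in_itv/= (lt_le_trans (atan_gtNpi2 _) ax).
  exact: le_lt_trans xb (atan_ltpi2 _).
have ctan : {in `[atan a, atan b]%classic, continuous (@tan R)}.
  by move=> x; rewrite inE => /cos_neq0; exact: continuous_tan.
have c1 : {in `[atan a, atan b]%classic,
    continuous (fun x : R => 1 + tan x ^+ 2)%R}.
  move=> x /ctan tanx; apply: cvgD; first exact: cvg_cst.
  by rewrite expr2; apply: cvgM.
transitivity (\int[mu]_(x in `]atan a, atan b]) (1 + tan x ^+ 2)%:E).
  rewrite integral_mkcond [RHS]integral_mkcond; apply: eq_integral => x _.
  rewrite !patchE /w /h patchE.
  have [xh|xh] := boolP (x \in halfturn); last first.
    rewrite if_same ifF//; apply/negbTE; apply: contra xh => /[!inE]/=.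
    rewrite !in_itv/= => /andP[ax xb].
    by rewrite (lt_trans (atan_gtNpi2 _) ax) (le_lt_trans xb (atan_ltpi2 _)).
  suff -> : (x \in (tan \_ halfturn) @^-1` `]a, b]) =
      (x \in `]atan a, atan b]%classic) by [].
  apply/idP/idP; rewrite !inE/= patchE xh !in_itv/=.
    by rewrite tan_itv// -inE.
  by rewrite tan_itv// -inE.
(* The fundamental theorem of calculus is applied on a closed interval; the added endpoint is a null
   set. *)
rewrite integral_itv_obnd_cbnd; last first.
  apply/measurable_EFinP; apply: (@measurable_funS _ _ _ _ `[atan a, atan b]).
  - exact: measurable_itv.
  - by apply: subset_itv; rewrite bnd_simp.
  - apply: subspace_continuous_measurable_fun => //.
    exact: continuous_in_subspaceT.
rewrite (@continuous_FTC2 _ _ tan)//.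
- by rewrite !atanK -EFinB.
- exact: lt_atan.
- exact: continuous_in_subspaceT.
- split.
  + move=> x xab; apply/derivable_tan/cos_neq0.
    exact: subset_itv_oo_cc.
  + apply/cvg_at_right_filter/continuous_tan/cos_halfturn_neq0.
    exact: atan_halfturn.
  + apply/cvg_at_left_filter/continuous_tan/cos_halfturn_neq0.
    exact: atan_halfturn.
- move=> x /subset_itv_oo_cc/cos_neq0 cx; rewrite derive1E.
  by have [_ ->] := is_derive_tan cx; rewrite cos2_tan2.
Qed.

(** On the open half-turn [cos t] is nonzero, and with radii of both signs the corresponding lines
    cover the plane except for the vertical axis, a null set. *)
Lemma ge0_integral_signed_polar (f : R * R -> \bar R) :
  measurable_fun setT f -> (forall z, 0 <= f z) ->
  \int[mu]_x \int[mu]_y f (x, y) =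
  \int[mu]_(t in halfturn) \int[mu]_r (f (r * cos t, r * sin t)%R * `|r|%:E).
Proof.
move=> mf f0.
have mfc (u v : R -> R) : measurable_fun setT u -> measurable_fun setT v ->
    measurable_fun setT (fun x => f (u x, v x)).
  move=> mu_ mv_; apply: (measurableT_comp mf).
  exact: measurable_fun_pair.
have mabs : measurable_fun setT (fun x : R => `|x|%:E) by exact/measurable_EFinP.
(* The integrand after the substitution [y = x * t], where [z.2] is the slope [t]. *)
pose g (z : R * R) := f (z.1, z.1 * z.2)%R * `|z.1|%:E.
have mg : measurable_fun setT g.
  apply: emeasurable_funM.
    apply: (measurableT_comp mf); apply: measurable_fun_pair => //=.
    exact: measurable_funM.
  exact: (measurableT_comp mabs).
have g0 z : 0 <= g z by rewrite mule_ge0.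
(* The scaling by [x] degenerates at [x = 0], so the outer integrands are compared away from this
   null point only. *)
have intD (u v : R -> \bar R) : measurable_fun setT u ->
    measurable_fun setT v -> (forall x, x != 0%R -> u x = v x) ->
    \int[mu]_x u x = \int[mu]_x v x.
  move=> mu_ mv_ uv; rewrite -(@integral_setD1 _ u 0%R)//; last 2 first.
  - exact: measurableD.
  - exact: measurable_funTS.
  rewrite -(@integral_setD1 _ v 0%R)//; last 2 first.
  - exact: measurableD.
  - exact: measurable_funTS.
  by apply: eq_integral => x /[!inE] -[_ /eqP]; exact: uv.
transitivity (\int[mu]_x \int[mu]_t g (x, t)).
  apply: intD => [||x x0].
  - exact: (@measurable_fun_fubini_tonelli_F _ _ (measurableTypeR R)
      (measurableTypeR R) R mu f mf f0).
  - exact: (@measurable_fun_fubini_tonelli_F _ _ (measurableTypeR R)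
      (measurableTypeR R) R mu g mg g0).
  rewrite (@ge0_lebesgue_affine _ x 0)//; last exact: mfc.
  by apply: eq_integral => t _; rewrite addr0.
rewrite (@fubini_tonelli _ _ (measurableTypeR R) (measurableTypeR R) R mu mu g mg g0)/=.
rewrite ge0_lebesgue_tan//; last 2 first.
- exact: (@measurable_fun_fubini_tonelli_G _ _ (measurableTypeR R)
      (measurableTypeR R) R mu g mg g0).
- by move=> t; apply: integral_ge0.
apply: eq_integral => t /set_mem th.
have ct := cos_halfturn_neq0 th.
rewrite (@ge0_lebesgue_affine _ (cos t) 0)//; last first.
  rewrite /g/=; apply: emeasurable_funM => //.
  by apply: mfc => //; exact: measurable_funM.
rewrite -ge0_integralZr//; last 3 first.
- apply: emeasurable_funM => //; apply: emeasurable_funM => //=.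
    by apply: mfc; repeat apply: measurable_funM => //;
       apply: measurable_funD => //; exact: measurable_funM.
  apply: (measurableT_comp mabs).
  by apply: measurable_funD => //; exact: measurable_funM.
- by move=> x _; rewrite !mule_ge0.
- by rewrite lee_fin addr_ge0// sqr_ge0.
apply: eq_integral => r _; rewrite /g/= addr0 -!muleA.
have -> : (cos t * r * tan t = r * sin t)%R by rewrite /tan; field.
rewrite (mulrC (cos t)) -!EFinM; congr (_ * _%:E).
(* One factor [|cos t|] comes from [|x|] and one from the substitution [x = cos t * r]; since
   [1 + tan t ^+ 2] is the inverse of [cos t ^+ 2], only [|r|] remains. *)
rewrite -cos2_tan2// normrM; have : `|cos t|%R != 0%R by rewrite normr_eq0.
by rewrite -[(cos t ^+ 2)%R]real_normK ?num_real// => ?; field.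
Qed.

Lemma ge0_integral_itv_cat (a b c : R) (f : R -> \bar R) :
  (a <= b)%R -> (b <= c)%R -> measurable_fun setT f -> (forall x, 0 <= f x) ->
  \int[mu]_(x in `[a, b[) f x + \int[mu]_(x in `[b, c[) f x =
  \int[mu]_(x in `[a, c[) f x.
Proof.
move=> ab bc mf f0.
rewrite [in RHS](@itv_bndbnd_setU _ _ (BLeft a) (BLeft b) (BLeft c))//.
rewrite ge0_integral_setU//; first exact: measurable_funTS.
apply/disj_setPRL => x /=; rewrite !in_itv/= => /andP[bx _].
by rewrite ltNge bx andbF.
Qed.

Lemma ge0_integral_itv_shift (a b e : R) (f : R -> \bar R) :
  measurable_fun setT f -> (forall x, 0 <= f x) ->
  \int[mu]_(x in `[a, b[) f (x + e)%R =
  \int[mu]_(x in `[(a + e)%R, (b + e)%R[) f x.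
Proof.
move=> mf f0; rewrite integral_indicE [RHS]integral_indicE.
rewrite [RHS](@ge0_lebesgue_affine _ 1 e)//; last 2 first.
- by apply: emeasurable_funM => //; exact/measurable_EFinP.
- by move=> x; rewrite mule_ge0// lee_fin.
apply: eq_integral => x _; rewrite mul1r normr1 mule1 !indicE !mem_setE.
by rewrite !in_itv/= lerD2r ltrD2r.
Qed.

(** Reflecting the negative half-line makes a signed radius positive; the endpoint 0 is null. *)
Lemma ge0_integral_sym (u : R -> \bar R) :
  measurable_fun setT u -> (forall x, 0 <= u x) ->
  \int[mu]_x u x = \int[mu]_(x in `]0%R, +oo[) (u x + u (- x)%R).
Proof.
move=> mu_ u0.
have mNu : measurable_fun setT (fun x : R => u (- x)%R) by exact: measurableT_comp.
rewrite ge0_integralD//; last 2 first.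
- exact: measurable_funTS.
- exact: measurable_funTS.
rewrite [X in _ + X]integral_itv_obnd_cbnd; last exact: measurable_funTS.
rewrite ge0_integration_by_substitution0//.
under [X in _ + X]eq_integral do rewrite opprK.
rewrite addeC -ge0_integral_setU//.
- by rewrite itv_setU_setT.
- exact: measurable_funTS.
- apply/disj_setPRL => x /=; rewrite !in_itv/= => /andP[x0 _].
  by rewrite leNgt x0.
Qed.

(** The shifted half-turn is the range from [pi / 2] to [3 * pi / 2]. The part of the other one
    below 0 is moved by a period to the range from [3 * pi / 2] to [2 * pi], and the pieces join up
    to null endpoints. *)
Lemma ge0_integral_turn (f : R -> \bar R) :
  measurable_fun setT f -> (forall x, 0 <= f x) ->
  (forall x, f (x + pi *+ 2)%R = f x) ->
  \int[mu]_(x in halfturn) f x + \int[mu]_(x in halfturn) f (x + pi)%R =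
  \int[mu]_(x in `[0%R, (2 * pi)%R]) f x.
Proof.
move=> mf f0 fper; have pi0 := @pi_gt0 R.
have mfD e : measurable_fun setT (fun x : R => f (x + e)%R).
  by apply: measurableT_comp => //; exact: measurable_funD.
rewrite !integral_itv_obnd_cbnd; [|exact: measurable_funTS..].
rewrite ge0_integral_itv_shift//.
rewrite -(@ge0_integral_itv_cat _ 0%R)//; last 2 first.
- lra.
- lra.
under eq_integral do rewrite -fper.
rewrite ge0_integral_itv_shift// add0r.
rewrite (_ : (- (pi / 2) + pi = pi / 2)%R); last by field.
rewrite (_ : (- (pi / 2) + pi *+ 2 = pi / 2 + pi)%R); last by field.
rewrite -addeA ge0_integral_itv_cat//; [|lra..].
rewrite addeC ge0_integral_itv_cat//; [|lra..].
rewrite integral_itv_bndo_bndc; last exact: measurable_funTS.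
by rewrite mulr_natl.
Qed.

Lemma ge0_integral_polar (f : R * R -> \bar R) :
  measurable_fun setT f -> (forall z, 0 <= f z) ->
  \int[mu]_x \int[mu]_y f (x, y) =
  \int[mu]_(r in `]0%R, +oo[) (r%:E *
    \int[mu]_(t in `[0%R, (2 * pi)%R]) f (r * cos t, r * sin t)%R).
Proof.
move=> mf f0; rewrite ge0_integral_signed_polar//.
pose g (z : R * R) := f (z.1 * cos z.2, z.1 * sin z.2)%R.
have mcos : measurable_fun setT (@cos R).
  by apply: continuous_measurable_fun; exact: continuous_cos.
have msin : measurable_fun setT (@sin R).
  by apply: continuous_measurable_fun; exact: continuous_sin.
have mg : measurable_fun setT g.
  apply: (measurableT_comp mf); apply: measurable_fun_pair => //=.
    by apply: measurable_funM => //; exact: measurableT_comp.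
  by apply: measurable_funM => //; exact: measurableT_comp.
have g0 z : 0 <= g z by exact: f0.
pose k (z : R * R) := g z * `|z.1|%:E.
have mk : measurable_fun setT k.
  apply: emeasurable_funM => //; apply/measurable_EFinP.
  exact: measurableT_comp.
have k0 z : 0 <= k z by rewrite mule_ge0.
(* Exchanging the integrals again puts the radius outside, where it can be folded at 0 for all
   angles at once. *)
rewrite -(@fubini_tonelli_in _ _ (measurableTypeR R) (measurableTypeR R) R
  mu mu halfturn k)//.
rewrite ge0_integral_sym; last 2 first.
- exact: (@measurable_integral_in _ _ (measurableTypeR R) (measurableTypeR R) R
    mu halfturn k).
- by move=> r; apply: integral_ge0.
have mgr r : measurable_fun setT (fun t => g (r, t)) by exact: measurableT_comp.
apply: eq_integral => r; rewrite inE/= in_itv/= andbT => r0.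
rewrite /k/= normrN gtr0_norm//.
have rE : 0 <= r%:E by rewrite lee_fin ltW.
rewrite !ge0_integralZr//; first last.
- by apply: measurable_funTS; exact: mgr.
- by apply: measurable_funTS; exact: mgr.
rewrite -ge0_muleDl; last 2 first.
- exact: integral_ge0.
- exact: integral_ge0.
rewrite muleC; congr (_ * _); rewrite -(@ge0_integral_turn (fun t => g (r, t)))//.
  (* Radius [- r] at angle [t] is the same point as radius [r] at angle [t + pi]. *)
  congr (_ + _); apply: eq_integral => t _.
  by rewrite /g/= cosDpi sinDpi !mulrN !mulNr.
by move=> t; rewrite /g/= cosD2pi sinD2pi.
Qed.

End polar_coordinates.

(** * Eigenvalues of the 2 by 2 matrix *)

Lemma char_poly2 (R : comNzRingType) (M : 'M[R]_2) :
  char_poly M = ('X - (M 0 0)%:P) * ('X - (M 1 1)%:P) - (M 0 1 * M 1 0)%:P.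
Proof.
have l01 : lift ord0 ord0 = 1 :> 'I_2 by exact/val_inj.
have l10 : lift 1 ord0 = 0 :> 'I_2 by exact/val_inj.
rewrite /char_poly (expand_det_row _ ord0) !big_ord_recl big_ord0 /cofactor.
rewrite !det_mx11 !mxE/= !l01 !l10 !mulr1n !mulr0n rmorphM/=; ring.
Qed.

(** The trace is 0 and the determinant is [- (a ^+ 2 + b ^+ 2)], so with [s] the square root the
    characteristic polynomial is ['X^2 - s^2] and the eigenvalues are [- s] and [s]. *)
Lemma real_sym_mx_level_spacing (R : realType) (a b : R) :
  is_level_spacing (real_sym_mx a b) (2 * Num.sqrt (a ^+ 2 + b ^+ 2)).
Proof.
set s := Num.sqrt _.
have s2 : s ^+ 2 = a ^+ 2 + b ^+ 2 by rewrite sqr_sqrtr// addr_ge0// sqr_ge0.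
exists (- s), s; split; first by rewrite ge0_cp ?sqrtr_ge0.
- have e0 : 0 = lshift 1 0 :> 'I_(1 + 1) by exact/val_inj.
  have e1 : 1 = rshift 1 0 :> 'I_(1 + 1) by exact/val_inj.
  have entry (c : R) : (c%:M : 'M[R]_1) 0 0 = c by rewrite mxE mulr1n.
  have M00 : real_sym_mx a b 0 0 = a by rewrite e0 [LHS]block_mxEul entry.
  have M01 : real_sym_mx a b 0 1 = b by rewrite e0 e1 [LHS]block_mxEur entry.
  have M10 : real_sym_mx a b 1 0 = b by rewrite e0 e1 [LHS]block_mxEdl entry.
  have M11 : real_sym_mx a b 1 1 = - a by rewrite e1 [LHS]block_mxEdr entry.
  rewrite char_poly2 M00 M01 M10 M11.
  transitivity ('X^2 - (s ^+ 2)%:P); last first.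
    by rewrite polyC_exp polyCN; ring.
  by rewrite s2 polyCD -expr2 !polyC_exp polyCN; ring.
- by rewrite opprK -mulr2n mulr_natl.
Qed.

(** * Law of the level spacing *)

Lemma ge0_integral_has_density (R : realType) d (T : measurableType d)
    (P : probability T R) (X : {RV P >-> R}) (g : R -> R) (f : R -> \bar R) :
  has_density P X (EFin \o g) ->
  measurable_fun setT f -> (forall x, 0 <= f x)%E ->
  (\int[distribution P X]_x f x = \int[lebesgue_measure]_x (f x * (g x)%:E))%E.
Proof.
move=> [[/measurable_EFinP mg g0 _] PXE] mf f0.
have g0' x : 0 <= g x by have := g0 x; rewrite lee_fin.
have mX : measurable_fun setT (X : T -> measurableTypeR R).
  exact: (measurable_funPT X).
rewrite ge0_integral_distribution//.
(* The detour through the integral over [T] retypes the distribution as a measure on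
   [measurableTypeR R], to be compared there with Lebesgue measure. *)
transitivity (\int[pushforward P (X : T -> measurableTypeR R)]_x f x)%E.
  by rewrite (ge0_integral_pushforward mX)//= preimage_setT.
exact: (@ge0_integral_density _ (measurableTypeR R) R lebesgue_measure
  (pushforward P (X : T -> measurableTypeR R)) g f mg g0' PXE mf f0).
Qed.

Section spacing_density.
Local Open Scope ereal_scope.
Context (R : realType) d (T : measurableType d) (P : probability T R).
Variables (ga gb : R -> R) (a b : {RV P >-> R}).
Hypotheses (ha : has_density P a (EFin \o ga))
           (hb : has_density P b (EFin \o gb)).
Notation mu := (@lebesgue_measure R).

Let mga : measurable_fun setT ga.
Proof. by case: ha => -[/measurable_EFinP]. Qed.

Let mgb : measurable_fun setT gb.
Proof. by case: hb => -[/measurable_EFinP]. Qed.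

Let ga0 x : (0 <= ga x)%R.
Proof. by case: ha => -[_ /(_ x)]; rewrite lee_fin. Qed.

Let gb0 x : (0 <= gb x)%R.
Proof. by case: hb => -[_ /(_ x)]; rewrite lee_fin. Qed.

(** Independence gives the joint law on measurable rectangles, hence identifies it with the product
    of the two laws; Tonelli then lets each law be replaced by its density in turn. *)
Lemma independent_joint_density (E : set (R * R)) :
  independent_RVs P a b -> measurable E ->
  P ((fun t => (a t, b t)) @^-1` E) =
  \int[mu]_x \int[mu]_y ((\1_E (x, y))%:E * (ga x * gb y)%:E).
Proof.
move=> hab mE; pose Z t : R * R := (a t, b t).
have mZ : measurable_fun setT Z by exact: measurable_fun_pair.
pose ZM := isMeasurableFun.Build _ _ _ _ _ mZ.
pose Z' : {mfun T >-> (R * R)%type} := HB.pack Z ZM.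
have ZE := @product_measure_unique _ _ R R R (distribution P a)
  (distribution P b) (distribution P Z') hab E mE.
transitivity (distribution P Z' E) => //; rewrite -ZE.
pose f (z : R * R) : \bar R := (\1_E z)%:E.
have mf : measurable_fun setT f by exact/measurable_EFinP.
have f0 z : 0 <= f z by rewrite lee_fin.
have mfy x : measurable_fun setT (fun y => f (x, y)) by exact: measurableT_comp.
transitivity (\int[distribution P a \x distribution P b]_z f z).
  by rewrite integral_indic// setIT.
rewrite (fubini_tonelli1 f)//.
rewrite (ge0_integral_has_density ha); last 2 first.
- exact: (@measurable_fun_fubini_tonelli_F _ _ _ _ R (distribution P b) f mf f0).
- by move=> x; apply: integral_ge0.
apply: eq_integral => x _; rewrite /fubini_F.
rewrite (ge0_integral_has_density hb)//.
rewrite -ge0_integralZr//; last 3 first.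
- by apply: emeasurable_funM; [exact: mfy|exact/measurable_EFinP].
- by move=> y _; rewrite mule_ge0// lee_fin.
- by rewrite lee_fin.
by apply: eq_integral => y _; rewrite -muleA -EFinM (mulrC (gb y)).
Qed.

Lemma measurable_spacing_pdf :
  measurable_fun setT (fun s : R => if (0 < s)%R then spacing_pdf ga gb s else 0).
Proof.
apply: measurable_fun_ifT => //.
  by apply: measurable_fun_ltr.
apply: emeasurable_funM; first by apply/measurable_EFinP; exact: measurable_funM.
have mS (h : R -> R) : measurable_fun setT h -> measurable_fun setT
    (fun z : R * R => z.1 / 2 * h z.2)%R.
  move=> mh; apply: measurable_funM; first exact: measurable_funM.
  exact: measurableT_comp.
pose k (z : R * R) := (ga (z.1 / 2 * cos z.2) * gb (z.1 / 2 * sin z.2))%:E.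
apply: (@measurable_integral_in _ _ (measurableTypeR R) (measurableTypeR R) R
  mu `[0%R, (2 * pi)%R] k) => //.
- apply/measurable_EFinP; apply: measurable_funM; apply: measurableT_comp => //;
    apply: mS; apply: continuous_measurable_fun.
  + exact: continuous_cos.
  + exact: continuous_sin.
- by move=> z; rewrite lee_fin mulr_ge0.
Qed.

Lemma spacing_pdf_ge0 s : 0 <= if (0 < s)%R then spacing_pdf ga gb s else 0.
Proof.
case: ifPn => // s0; apply: mule_ge0; first by rewrite lee_fin divr_ge0// ltW.
by apply: integral_ge0 => t _; rewrite lee_fin mulr_ge0.
Qed.

Lemma distribution_level_spacing (A : set R) :
  independent_RVs P a b -> measurable A ->
  distribution P (level_spacing a b) A =
  \int[mu]_(s in A) (if (0 < s)%R then spacing_pdf ga gb s else 0).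
Proof.
move=> hab mA; pose S (z : R * R) := (2 * Num.sqrt (z.1 ^+ 2 + z.2 ^+ 2))%R.
have mS : measurable_fun setT S.
  apply: measurable_funM => //; apply: measurableT_comp.
    by apply: continuous_measurable_fun; exact: sqrt_continuous.
  by apply: measurable_funD; exact: measurable_funX.
have mE : measurable (S @^-1` A) by rewrite -[X in measurable X]setTI; exact: mS.
pose f (z : R * R) := (\1_(S @^-1` A) z)%:E * (ga z.1 * gb z.2)%:E.
have mf : measurable_fun setT f.
  apply: emeasurable_funM; first exact/measurable_EFinP.
  by apply/measurable_EFinP; apply: measurable_funM; exact: measurableT_comp.
have f0 z : 0 <= f z by rewrite mule_ge0 ?lee_fin ?mulr_ge0.
transitivity (P ((fun t => (a t, b t)) @^-1` (S @^-1` A))) => //.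
rewrite independent_joint_density// (ge0_integral_polar mf f0).
rewrite integral_indicE [RHS]integral_indicE.
(* The substitution [s = 2 * r] has weight 2, which turns the prefactor [s / 4] into the Jacobian
   [r] of polar coordinates. *)
rewrite [RHS](@ge0_lebesgue_affine _ 2 0)//; last 2 first.
- apply: emeasurable_funM; last exact/measurable_EFinP.
  exact: measurable_spacing_pdf.
- by move=> s; rewrite mule_ge0 ?spacing_pdf_ge0// lee_fin.
apply: eq_integral => r _; rewrite addr0 pmulr_rgt0// normr_nat.
have -> : \1_`]0%R, +oo[%classic r = (0 < r)%R%:R :> R.
  by rewrite indicE mem_setE in_itv/= andbT.
(* For [r <= 0] both sides vanish: the left by its indicator, the right by its conditional. *)
have [r0|r0] := ltP 0%R r; last by rewrite mule0 !mul0e.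
rewrite mule1 /spacing_pdf.
(* The spacing does not depend on the angle, so the indicator of the event leaves the angular
   integral. *)
have Sr t : S (r * cos t, r * sin t)%R = (2 * r)%R.
  rewrite /S/= !exprMn -mulrDr cos2Dsin2 mulr1 sqrtr_sqr gtr0_norm//.
have r2 : (2 * r / 2 = r)%R by field.
rewrite r2; set h := fun t : R => (ga (r * cos t) * gb (r * sin t))%:E.
have mh : measurable_fun setT h.
  apply/measurable_EFinP; apply: measurable_funM; apply: measurableT_comp => //;
    apply: measurable_funM => //; apply: continuous_measurable_fun.
  - exact: continuous_cos.
  - exact: continuous_sin.
transitivity (r%:E * \int[mu]_(t in `[0%R, (2 * pi)%R])
    ((\1_A (2 * r)%R)%:E * h t)).
  congr (_ * _); apply: eq_integral => t _.
  by rewrite /f /h !indicE -(Sr t).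
rewrite ge0_integralZl//; last 2 first.
- exact: measurable_funTS.
- by move=> t _; rewrite lee_fin mulr_ge0.
set J := \int[mu]_(t in _) h t.
rewrite [LHS]muleA [LHS]muleC [in RHS](muleC _ J) -!muleA -!EFinM.
by congr (_ * _%:E); field.
Qed.

Lemma has_density_level_spacing : independent_RVs P a b ->
  has_density P (level_spacing a b)
    (fun s : R => if (0 < s)%R then spacing_pdf ga gb s else 0).
Proof.
move=> hab; split; last by move=> A mA; exact: distribution_level_spacing.
split; [exact: measurable_spacing_pdf|exact: spacing_pdf_ge0|].
(* The total mass is read off from the law itself, at the full set. *)
by rewrite -distribution_level_spacing// probability_setT.
Qed.

End spacing_density.

(** * Linear repulsion near zero spacing *)

Section spacing_repulsion.
Local Open Scope ereal_scope.
Context (R : realType) (ga gb : R -> R).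
Hypotheses (mga : measurable_fun setT ga) (mgb : measurable_fun setT gb).
Hypotheses (ga0 : forall x, (0 <= ga x)%R) (gb0 : forall x, (0 <= gb x)%R).
Notation mu := (@lebesgue_measure R).

(** Dividing by [s] leaves a quarter of an integral over an interval of length [2 * pi], so a bound
    on the integrand uniform in the angle is multiplied by [pi / 2]. *)
Lemma spacing_pdf_div_bounds (s e : R) : (0 < s)%R -> (0 <= e)%R ->
  (forall t, `|ga (s / 2 * cos t) * gb (s / 2 * sin t) - ga 0 * gb 0| <= e)%R ->
  (pi / 2 * (ga 0 * gb 0 - e))%:E <= spacing_pdf ga gb s * (s^-1)%:E
    <= (pi / 2 * (ga 0 * gb 0 + e))%:E.
Proof.
move=> s0 e0; set L := (ga 0 * gb 0)%R => gL; have pi0 := @pi_gt0 R.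
pose h t := (ga (s / 2 * cos t) * gb (s / 2 * sin t))%R.
have h0 t : (0 <= h t)%R by rewrite mulr_ge0.
have mh : measurable_fun setT h.
  apply: measurable_funM; apply: measurableT_comp => //;
    apply: measurable_funM => //; apply: continuous_measurable_fun.
  - exact: continuous_cos.
  - exact: continuous_sin.
have mhE : measurable_fun `[0%R, (2 * pi)%R] (EFin \o h).
  by apply: measurable_funTS; exact/measurable_EFinP.
have cstE (c : R) : \int[mu]_(t in `[0%R, (2 * pi)%R]) c%:E = (2 * pi * c)%:E.
  rewrite integral_cst//= lebesgue_measure_itv/= lte_fin mulr_gt0//.
  by rewrite -EFinD -EFinM subr0 mulrC.
have L0 : (0 <= L)%R by rewrite mulr_ge0.
set J := \int[mu]_(t in `[0%R, (2 * pi)%R]) (h t)%:E.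
have -> : spacing_pdf ga gb s * (s^-1)%:E = (4^-1)%:E * J.
  rewrite /spacing_pdf -/J muleAC -EFinM; congr (_%:E * _); field.
  by rewrite gt_eqF.
have Jge : (2 * pi * (L - e))%:E <= J.
  (* [L - e] may be negative, whereas the comparison of integrals is between nonnegative functions;
     hence the truncation at 0. *)
  apply: (@le_trans _ _ (2 * pi * Num.max 0 (L - e))%:E).
    by rewrite lee_fin ler_pM2l ?mulr_gt0// le_max lexx orbT.
  rewrite -cstE; apply: ge0_le_integral => //.
  - by move=> t _; rewrite lee_fin le_max lexx.
  - move=> t _; rewrite lee_fin ge_max h0/=.
    by have := gL t; rewrite ler_distl => /andP[].
have Jle : J <= (2 * pi * (L + e))%:E.
  rewrite -cstE; apply: ge0_le_integral => //.
  - by move=> t _; rewrite lee_fin.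
  - move=> t _; rewrite lee_fin.
    by have := gL t; rewrite ler_distl => /andP[].
apply/andP; split.
- rewrite (_ : (pi / 2 * (L - e) = 4^-1 * (2 * pi * (L - e)))%R); last by field.
  by rewrite EFinM lee_pmul2l// lte_fin.
- rewrite (_ : (pi / 2 * (L + e) = 4^-1 * (2 * pi * (L + e)))%R); last by field.
  by rewrite EFinM lee_pmul2l// lte_fin.
Qed.

Lemma cvg_spacing_pdf_div :
  {for 0%R, continuous ga} -> {for 0%R, continuous gb} ->
  (spacing_pdf ga gb s * (s^-1)%:E) @[s --> (0%R : R)^'+]
    --> (pi / 2 * ga 0 * gb 0)%:E.
Proof.
move=> cga cgb; have pi0 := @pi_gt0 R.
have gL (e : R) : (0 < e)%R -> \forall s \near (0%R : R)^'+, forall t,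
    (`|ga (s / 2 * cos t) * gb (s / 2 * sin t) - ga 0 * gb 0| <= e)%R.
  move=> e0.
  have : (ga z.1 * gb z.2)%R @[z --> ((0, 0)%R : R * R)] --> (ga 0 * gb 0)%R.
    apply: cvgM.
    - by apply: (@cvg_comp _ _ _ fst ga _ (nbhs (0%R : R))) => //; exact: cvg_fst.
    - by apply: (@cvg_comp _ _ _ snd gb _ (nbhs (0%R : R))) => //; exact: cvg_snd.
  move/cvgrPdist_le => /(_ _ e0)[[A B]/= [nA nB] AB].
  have [r /= r0 rAB] : nbhs_ball (0%R : R) (A `&` B).
    by apply/nbhs_ballP; exact: filterI.
  near=> s; move=> t.
  have s0 : (0 < s)%R by [].
  have sr : (s < r)%R by near: s; exact: nbhs_right_lt.
  (* Sine and cosine enter only through their bound 1, which makes the estimate uniform in the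
     angle. *)
  have small u : (-1 <= u <= 1)%R -> ball (0%R : R) r (s / 2 * u)%R.
    move=> /andP[u1 u2]; rewrite /ball/= sub0r normrN ltr_norml.
    apply/andP; split; nra.
  rewrite distrC; apply: (AB (_, _)); split => /=.
  - apply: (rAB _ _).1; apply: small; by rewrite cos_geN1 cos_le1.
  - apply: (rAB _ _).2; apply: small; by rewrite sin_geN1 sin_le1.
set v := (fun s => _).
have vb (e : R) : (0 < e)%R -> \forall s \near (0%R : R)^'+,
    (pi / 2 * ga 0 * gb 0 - e)%:E <= v s <= (pi / 2 * ga 0 * gb 0 + e)%:E.
  (* Chosen so that the factor [pi / 2] of the angular integral gives back [e]. *)
  move=> e0; pose e' := (e / (pi / 2))%R.
  have e'0 : (0 < e')%R by rewrite !divr_gt0.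
  near=> s.
  have s0 : (0 < s)%R by [].
  have gLs : forall t,
    (`|ga (s / 2 * cos t) * gb (s / 2 * sin t) - ga 0 * gb 0| <= e')%R.
    by near: s; exact: gL.
  have := spacing_pdf_div_bounds s0 (ltW e'0) gLs.
  rewrite /e' mulrBr mulrDr (mulrC (pi / 2) (_ / _))%R divfK ?mulrA//.
  by rewrite gt_eqF// divr_gt0.
have vfin x y s : x%:E <= v s <= y%:E -> v s \is a fin_num.
  move=> /andP[xv vy]; rewrite fin_numElt (lt_le_trans _ xv) ?ltNyr//.
  by rewrite (le_lt_trans vy) ?ltry.
(* The bounds at tolerance 1 already show the quotient finite near 0, which reduces the limit to one
   in the reals. *)
apply/fine_cvgP; split; first by apply: filterS (vb 1%R ltr01) => s /vfin.
apply/cvgrPdist_le => e e0; apply: filterS (vb e e0) => s sb.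
by move: (sb); rewrite ler_distlC -(fineK (vfin _ _ _ sb)) !lee_fin.
Unshelve. all: by end_near. Qed.

End spacing_repulsion.

Theorem mainTheorem4 (R : realType) (d : measure_display)
    (T : measurableType d) (P : probability T R)
    (ga gb : R -> R) (a b : {RV P >-> R})
    (ha : has_density P a (EFin \o ga)) (hb : has_density P b (EFin \o gb))
    (hab : independent_RVs P a b) :
  [/\ forall t : T,
        is_level_spacing (real_sym_mx (a t) (b t)) (level_spacing a b t),
      has_density P (level_spacing a b)
        (fun s : R => if 0 < s then spacing_pdf ga gb s else 0%E) &
      {for 0, continuous ga} -> {for 0, continuous gb} ->
      (spacing_pdf ga gb s * (s^-1)%:E)%E @[s --> 0^'+]
        --> (pi / 2 * ga 0 * gb 0)%:E
      /\ (0 < ga 0 -> 0 < gb 0 -> repulsion_exponent (spacing_pdf ga gb) 1)].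
Proof.
split; first by move=> t; exact: real_sym_mx_level_spacing.
  exact: has_density_level_spacing.
move=> cga cgb; have [[/measurable_EFinP mga ga0 _] _] := ha.
have [[/measurable_EFinP mgb gb0 _] _] := hb.
have lim := cvg_spacing_pdf_div mga mgb ga0 gb0 cga cgb.
split => // ga0_gt0 gb0_gt0; exists (pi / 2 * ga 0 * gb 0).
  by rewrite !mulr_gt0 ?invr_gt0 ?pi_gt0.
apply: cvg_trans lim; apply: near_eq_cvg; near=> s.
(* The power with exponent 1 is rewritten as [s] using nonnegativity, which the right-sided filter
   supplies. *)
by rewrite powRr1 ?ltW//; near: s; exact: nbhs_right_gt.
Unshelve. all: by end_near. Qed.
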